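(* Let $\mathrm{PR}$ be the model over $\mathbb N$ consisting of all partial recursive functions $\mathbb N\to\mathbb N\cup\{\bot\}$. Then $\mathrm{PR}$ is complete: for every model $M$ over $\mathbb N$ with $M\supseteq\mathrm{PR}$ and $\mathrm{PR}\succsim M$, we have $M=\mathrm{PR}$.
   Context: A model of computation over a set $D$ is any set of functions $f:D\to D\cup\{\bot\}$, where $\bot$ denotes ''undefined'' (a partial function is identified with such a function, $\bot$ marking the points where it is undefined). An encoding is an injection $\rho:\mathrm{dom}\,B\to\mathrm{dom}\,A$, extended by $\rho(\bot)=\bot$. Model $A$ simulates model $B$ via $\rho$, written $A\succsim_\rho B$, if for every $g\in B$ there is $f\in A$ with $\rho\circ g=f\circ\rho$. $A\succsim B$ means $A\succsim_\rho B$ for some injection $\rho$. *)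

(* Defs.v *)
From mathcomp Require Import all_boot.
From mathcomp Require Import boolp classical_sets.
Set Implicit Arguments.
Unset Strict Implicit.
Unset Printing Implicit Defensive.
Local Open Scope classical_set_scope.

(* [None] plays the role of the undefined value. *)
Definition model (D : Type) := set (D -> option D).

(* [omap rho] is the encoding extended by sending undefined to undefined. *)
Definition simulates_via (DA DB : Type) (A : model DA) (B : model DB)
    (rho : DB -> DA) : Prop :=
  forall g, B g -> exists f, A f /\ omap rho \o g = f \o rho.

Definition simulates (DA DB : Type) (A : model DA) (B : model DB) : Prop :=
  exists rho : DB -> DA, injective rho /\ simulates_via A B rho.

Definition pfun (n : nat) := n.-tuple nat -> option nat.

(* Composition is strict: every inner function must be defined, even those
   whose value the outer function ignores. *)
Definition is_comp (m n : nat) (f : pfun m) (gs : 'I_m -> pfun n)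
    (h : pfun n) : Prop :=
  forall v y, h v = Some y <->
    exists w : m.-tuple nat,
      (forall i, gs i v = Some (tnth w i)) /\ f w = Some y.

Definition is_prec (n : nat) (f : pfun n) (g : pfun n.+2)
    (h : pfun n.+1) : Prop :=
  (forall v : n.-tuple nat, h [tuple of 0 :: v] = f v) /\
  (forall k (v : n.-tuple nat), h [tuple of k.+1 :: v] =
     obind (fun r => g [tuple of k :: r :: v]) (h [tuple of k :: v])).

(* The search is also undefined when [f] diverges before its first zero. *)
Definition is_min (n : nat) (f : pfun n.+1) (h : pfun n) : Prop :=
  forall (v : n.-tuple nat) y, h v = Some y <->
    f [tuple of y :: v] = Some 0 /\
    forall k, k < y -> exists z, f [tuple of k :: v] = Some z.+1.

Inductive partial_recursive : forall n, pfun n -> Prop :=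
| pr_zero n : @partial_recursive n (fun=> Some 0)
| pr_succ : @partial_recursive 1 (fun v => Some (thead v).+1)
| pr_proj n (i : 'I_n) : @partial_recursive n (fun v => Some (tnth v i))
| pr_comp m n (f : pfun m) (gs : 'I_m -> pfun n) (h : pfun n) :
    partial_recursive f -> (forall i, partial_recursive (gs i)) ->
    is_comp f gs h -> partial_recursive h
| pr_prec n (f : pfun n) (g : pfun n.+2) (h : pfun n.+1) :
    partial_recursive f -> partial_recursive g ->
    is_prec f g h -> partial_recursive h
| pr_min n (f : pfun n.+1) (h : pfun n) :
    partial_recursive f -> is_min f h -> partial_recursive h.

Definition PR : model nat :=
  [set f | @partial_recursive 1 (fun v => f (thead v))].

(* Main.v *)
Require Import Defs.
From mathcomp Require Import all_boot.
From mathcomp Require Import boolp classical_sets.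
Local Open Scope classical_set_scope.

(** Since the successor function lies in [M], some partial recursive [s]
    satisfies [rho n.+1 = s (rho n)]; hence the encoding [rho] is itself
    recursive, by iterating [s] from [rho 0].  If a partial recursive [f]
    simulates [g], injectivity of [rho] then gives
    [g n = mu m. rho m = f (rho n)], so [g] is partial recursive. *)

Lemma theadE_nth n (v : n.+1.-tuple nat) : thead v = nth 0 v 0.
Proof. exact: tnth_nth. Qed.

Lemma pr_ext n (f g : pfun n) :
  f =1 g -> partial_recursive f -> partial_recursive g.
Proof. by move=> /funext ->. Qed.

Lemma pr_nth n i : i < n -> @partial_recursive n (fun v => Some (nth 0 v i)).
Proof.
move=> lt_in; apply: pr_ext (pr_proj (Ordinal lt_in)) => v /=.
by rewrite (tnth_nth 0).
Qed.

Lemma pr_comp1 n (f : nat -> option nat) (g : pfun n) :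
  PR f -> partial_recursive g -> partial_recursive (fun v => obind f (g v)).
Proof.
move=> prf prg; apply: (@pr_comp 1 n _ (fun=> g) _ prf) => // v y.
split=> [|[w [gw fw]]]; last by rewrite (gw ord0).
case gv: (g v) => [a|//] /= fa; exists [tuple a]; split=> // i.
by rewrite ord1.
Qed.

Lemma pr_comp2 n (f : nat -> nat -> option nat) (g1 g2 : pfun n) :
  @partial_recursive 2 (fun v => f (nth 0 v 0) (nth 0 v 1)) ->
  partial_recursive g1 -> partial_recursive g2 ->
  partial_recursive (fun v => obind (fun a => obind (f a) (g2 v)) (g1 v)).
Proof.
move=> prf prg1 prg2.
apply: (@pr_comp 2 n _ (fun i => if i == ord0 then g1 else g2) _ prf).
  by move=> i; case: ifP.
move=> v y; split=> [|[w [gw]]].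
  case gv1: (g1 v) => [a|//] /=; case gv2: (g2 v) => [b|//] /= fab.
  by exists [tuple a; b]; split=> // -[[|[|//]] ?].
move: (gw ord0) (gw ord_max); rewrite !(tnth_nth 0) /= => -> ->.
by [].
Qed.

Lemma pr_const n c : @partial_recursive n (fun=> Some c).
Proof.
elim: c => [|c IHc]; first exact: pr_zero.
exact: (@pr_comp1 n (fun x => Some x.+1) _ pr_succ IHc).
Qed.

Lemma PR_pred : PR (fun x => Some x.-1).
Proof.
(* Entry 0 of the step function's arguments is the recursion index [k], already the predecessor of
   [k.+1]. *)
apply: (@pr_prec 0 (fun=> Some 0) (fun v => Some (nth 0 v 0))).
- exact: pr_zero.
- exact: pr_nth.
- by split=> [v|k v]; rewrite !theadE_nth.
Qed.

Lemma pr_add :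
  @partial_recursive 2 (fun v => Some (nth 0 v 0 + nth 0 v 1)).
Proof.
apply: (@pr_prec 1 (fun v => Some (nth 0 v 0))
                   (fun v => Some (nth 0 v 1).+1)).
- exact: pr_nth.
- exact: (@pr_comp1 3 (fun x => Some x.+1) _ pr_succ (@pr_nth 3 1 isT)).
- by split=> [v|k v].
Qed.

(** Primitive recursion runs on the first argument, so the subtrahend must come first; each step
    takes one predecessor. *)
Lemma pr_subr :
  @partial_recursive 2 (fun v => Some (nth 0 v 1 - nth 0 v 0)).
Proof.
apply: (@pr_prec 1 (fun v => Some (nth 0 v 0))
                   (fun v => Some (nth 0 v 1).-1)).
- exact: pr_nth.
- exact: (@pr_comp1 3 (fun x => Some x.-1) _ PR_pred (@pr_nth 3 1 isT)).
- by split=> [v|k v] /=; rewrite ?subn0 // subnS.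
Qed.

(** Subtraction is truncated, so one summand always vanishes and the sum is the absolute difference.
    It turns an equality test into the zero test used by minimization. *)
Definition dist (x y : nat) : nat := (y - x) + (x - y).

Lemma dist_eq0 x y : (dist x y == 0) = (x == y).
Proof. by rewrite addn_eq0 !subn_eq0 eqn_leq andbC. Qed.

Lemma pr_dist :
  @partial_recursive 2 (fun v => Some (dist (nth 0 v 0) (nth 0 v 1))).
Proof.
have p0 := @pr_nth 2 0 isT; have p1 := @pr_nth 2 1 isT.
have subC := @pr_comp2 2 (fun x y => Some (y - x)) _ _ pr_subr p1 p0.
exact: (@pr_comp2 2 (fun x y => Some (x + y)) _ _ pr_add pr_subr subC).
Qed.

Lemma PR_succ : PR (fun x => Some x.+1).
Proof. exact: pr_succ. Qed.

(** Primitive recursion with the constant [r 0] as base and [s] as step: [s] may be partial, but it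
    is defined all along the orbit of [r 0]. *)
Lemma PR_iterate (s : nat -> option nat) (r : nat -> nat) :
  PR s -> (forall n, s (r n) = Some (r n.+1)) -> PR (fun n => Some (r n)).
Proof.
move=> prs sr.
apply: (@pr_prec 0 (fun=> Some (r 0)) (fun v => s (nth 0 v 1))).
- exact: pr_const.
- exact: (@pr_comp1 2 _ _ prs (@pr_nth 2 1 isT)).
- by split=> [v|k v]; rewrite !theadE_nth //= sr.
Qed.

Lemma PR_conjugate (f g : nat -> option nat) (r : nat -> nat) :
  injective r -> PR (fun n => Some (r n)) -> PR f ->
  (forall n, omap r (g n) = f (r n)) -> PR g.
Proof.
move=> rI prr prf fg.
have pr0 := @pr_comp1 2 _ _ prr (@pr_nth 2 0 isT).
have pr1 := @pr_comp1 2 _ _ prf (@pr_comp1 2 _ _ prr (@pr_nth 2 1 isT)).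
(* With the candidate in entry 0 and the input [n] in entry 1, this is the distance from [r m] to
   [f (r n)]. It diverges for every [m] when [f (r n)] is undefined, so the search is then
   undefined, as [g n] is. *)
have prd := @pr_comp2 2 (fun x y => Some (dist x y)) _ _ pr_dist pr0 pr1.
apply: pr_min prd _ => v y; rewrite theadE_nth /= -fg.
case: (g _) => [b|] /=; last by split=> // -[].
split=> [[->]|[[/eqP]]]; last by rewrite dist_eq0 => /eqP/rI ->.
split=> [|k ltky]; first by congr Some; apply/eqP; rewrite dist_eq0.
(* By injectivity of [r], no candidate below [y] is a zero. *)
have: dist (r k) (r y) != 0.
  by rewrite dist_eq0; apply: contraTneq ltky => /rI ->; rewrite ltnn.
by case: (dist _ _) => // z _; exists z.
Qed.

Theorem mainTheorem3 (M : model nat) (hPR : PR `<=` M) (hsim : simulates PR M) :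
  M = PR.
Proof.
case: hsim => r [rI sim]; apply/seteqP; split=> // g Mg.
have [s [prs rs]] := sim _ (hPR _ PR_succ).
have [f [prf rf]] := sim _ Mg.
have prr : PR (fun n => Some (r n)).
  by apply: PR_iterate prs _ => n; rewrite -[LHS]/((s \o r) n) -rs.
by apply: PR_conjugate rI prr prf _ => n; rewrite -[RHS]/((f \o r) n) -rf.
Qed.
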